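(* There exist a Hilbert space $H$, a weakly stable unitary operator $U$ on $H$ and an operator $A\in\mathcal{L}(H)$ such that the Cesàro means $$\frac{1}{N}\sum_{n=1}^N U^nAU^n$$ do not converge in the weak operator topology as $N\to\infty$.
   Context: $\mathcal{L}(H)$ is the space of bounded linear operators on $H$. An operator $U$ is called weakly stable if $\lim_{n\to\infty}U^n=0$ in the weak operator topology. *)

(* Defs.v *)
From HB Require Import structures.
From mathcomp Require Import all_boot all_order all_algebra.
From mathcomp Require Import all_classical all_reals topology normedtype.

Set Implicit Arguments.
Unset Strict Implicit.
Unset Printing Implicit Defensive.

Import Order.TTheory GRing.Theory Num.Theory.
Import numFieldNormedType.Exports.

Local Open Scope classical_set_scope.
Local Open Scope ring_scope.

(* The scalar field C is any numClosedFieldType; complex Hilbert spaces in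
   the usual sense are obtained with C := R[i] for R : realType.              *)

(* As for every {dot _ for _}, the form is linear in its first argument and
   conjugate-linear in the second one.                                        *)
HB.mixin Record CompleteNormedModule_isHilbert (C : numClosedFieldType) H
    & CompleteNormedModule C H := {
  inner : {dot H for (@Num.conj C)} ;
  inner_norm : forall x : H, inner x x = `|x| ^+ 2
}.

#[short(type="hilbertType")]
HB.structure Definition Hilbert (C : numClosedFieldType) :=
  {H of CompleteNormedModule C H & CompleteNormedModule_isHilbert C H}.

Notation "''<' x , y >" := (inner x y)
  (at level 8, x at level 69, y at level 69, format "''<' x ,  y >") : ring_scope.

Section bounded_operators.
Context {C : numClosedFieldType} (H : hilbertType C).

Definition bounded_operator_pred : {pred H -> H} := fun T : H -> H =>
  `[< linear T /\ exists M : C, forall x, `|T x| <= M * `|x| >].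

Record bounded_operator := BoundedOperator {
  bounded_operator_fun :> H -> H ;
  _ : bounded_operator_fun \in bounded_operator_pred }.

HB.instance Definition _ := [isSub for bounded_operator_fun].
HB.instance Definition _ := [Choice of bounded_operator by <:].

Lemma bounded_operatorP (T : bounded_operator) :
  linear T /\ exists M : C, forall x, `|T x| <= M * `|x|.
Proof. by case: T => T /= /asboolP. Qed.

Lemma bounded_operator_ext (S T : bounded_operator) : S =1 T -> S = T.
Proof. by move=> ST; apply: val_inj; apply/funext. Qed.

HB.instance Definition _ (T : bounded_operator) :=
  GRing.isLinear.Build C H H *:%R T (proj1 (bounded_operatorP T)).

Lemma bounded_operator_submod_closed : submod_closed bounded_operator_pred.
Proof.
split=> [|a S T /asboolP[Sl [M SM]] /asboolP[Tl [N TN]]]; apply/asboolP; split.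
- by move=> a x y; rewrite /= scaler0 addr0.
- by exists 0 => x; rewrite normr0 mul0r.
- move=> b x y; rewrite !fctE Sl Tl !scalerDr addrACA !scalerA.
  by rewrite (mulrC a b).
- exists (`|a| * M + N) => x; rewrite mulrDl -mulrA.
  rewrite (le_trans (ler_normD _ _))// lerD// normrZ.
  exact: ler_wpM2l.
Qed.

HB.instance Definition _ := GRing.isSubmodClosed.Build C (H -> H)
  bounded_operator_pred bounded_operator_submod_closed.
HB.instance Definition _ :=
  [SubChoice_isSubLmodule of bounded_operator by <:].

Lemma idop_subproof : idfun \in bounded_operator_pred.
Proof. by apply/asboolP; split=> //; exists 1 => x; rewrite mul1r. Qed.

Definition idop := BoundedOperator idop_subproof.

Lemma compop_subproof (S T : bounded_operator) :
  S \o T \in bounded_operator_pred.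
Proof.
have [Sl [M SM]] := bounded_operatorP S.
have [Tl [N TN]] := bounded_operatorP T.
apply/asboolP; split=> [a x y /=|]; first by rewrite !linearP.
exists (`|M| * `|N|) => x /=.
have le_abs (K : C) (u v : H) : `|u| <= K * `|v| -> `|u| <= `|K| * `|v|.
  move=> uv; rewrite (le_trans uv)//.
  have := le_trans (normr_ge0 _) uv.
  by move=> Kv; rewrite -(ger0_norm Kv) normrM normr_id.
by rewrite -mulrA (le_trans (le_abs _ _ _ (SM _)))// ler_wpM2l// le_abs.
Qed.

Definition compop S T := BoundedOperator (compop_subproof S T).

Lemma compopA : associative compop.
Proof. by move=> A B D; apply: bounded_operator_ext. Qed.

Lemma comp1op : left_id idop compop.
Proof. by move=> A; apply: bounded_operator_ext. Qed.

Lemma compop1 : right_id idop compop.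
Proof. by move=> A; apply: bounded_operator_ext. Qed.

Lemma compopDl : left_distributive compop +%R.
Proof. by move=> A B D; apply: bounded_operator_ext. Qed.

Lemma compopDr : right_distributive compop +%R.
Proof.
by move=> A B D; apply: bounded_operator_ext => x /=; rewrite linearD.
Qed.

(* The product of the ring of operators is composition: (S * T) x = S (T x). *)
HB.instance Definition _ := GRing.Zmodule_isPzRing.Build bounded_operator
  compopA comp1op compop1 compopDl compopDr.

End bounded_operators.

Notation "''L' ( H )" := (bounded_operator H)
  (at level 8, format "''L' ( H )") : type_scope.

Section operators.
Context {C : numClosedFieldType} {H : hilbertType C}.

Definition is_adjoint (T S : 'L(H)) := forall x y : H, '<T x, y> = '<x, S y>.

Definition unitary (U : 'L(H)) :=
  exists V : 'L(H), [/\ is_adjoint U V, U * V = 1 & V * U = 1].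

Definition matrix_coef (T : 'L(H)) : {ptws H * H -> C} :=
  fun p => '<T p.1, p.2>.

End operators.

(* The weak operator topology: the coarsest topology on 'L(H) which makes all
   the maps T |-> '<T x, y> continuous.                                       *)
Definition wot {C : numClosedFieldType} (H : hilbertType C) :=
  initial_topology (@matrix_coef C H).

HB.instance Definition _ (C : numClosedFieldType) (H : hilbertType C) :=
  Topological.on (wot H).

Lemma cvg_wotP {C : numClosedFieldType} (H : hilbertType C)
    (F : set_system 'L(H)) (T : 'L(H)) : Filter F ->
  F --> (T : wot H) <->
  forall x y : H, (fun S : 'L(H) => '<S x, y>) @ F --> '<T x, y>.
Proof.
move=> FF; split=> [FT x y|FT A].
- have cF : (@matrix_coef C H) @ F --> (matrix_coef T : {ptws H * H -> C}).
    exact: cvg_trans (cvg_app (@matrix_coef C H : wot H -> _) FT)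
      (@initial_continuous _ _ (@matrix_coef C H) T).
  exact: cvg_trans (cvg_app (proj (x, y)) cF)
    (@proj_continuous _ (fun=> C) (x, y) _).
- have cF : (@matrix_coef C H) @ F --> (matrix_coef T : {ptws H * H -> C}).
    by apply/pointwise_cvgP => -[x y]; exact: FT.
  rewrite nbhsE => -[_ [[B Bo <-] BT] BA].
  by apply: (filterS BA); apply: cF; exact: open_nbhs_nbhs.
Qed.

Definition weakly_stable {C : numClosedFieldType} {H : hilbertType C}
    (U : 'L(H)) :=
  (fun n => U ^+ n : wot H) @ \oo --> ((0 : 'L(H)) : wot H).

(* Main.v *)
(* On H = l^2(Z) let U be the bilateral shift e_k |-> e_{k+1}, which is unitary
   and weakly stable, and let A e_k = c_{|k|} e_{-k} with c_n in {0, 1}.  Since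
   <U^n A U^n e_0, e_0> = c_n, it suffices to choose c whose Cesaro means diverge:
   with c_n = 1 iff the integer part of log_2 n is even, the means over
   [1, 2^k) are exactly 1/3 for k even and at least 2/3 for k odd.
   Weak stability holds because U^j moves the support of a truncation to
   [-n, n) off [-n, n) as soon as j >= 2n. *)

From HB Require Import structures.
Require Import Defs.
From mathcomp Require Import all_boot all_order all_algebra.
From mathcomp Require Import all_classical all_reals topology normedtype.
From mathcomp Require Import sequences ring zify.
From mathcomp Require Import complex.

Set Implicit Arguments.
Unset Strict Implicit.
Unset Printing Implicit Defensive.

Import Order.TTheory GRing.Theory Num.Theory.
Import numFieldNormedType.Exports.

Local Open Scope classical_set_scope.
Local Open Scope ring_scope.

(* The topological structures of a numClosedFieldType are keyed on
   Num.ClosedField.sort, so they are not inferred on the bare type R[i]. *)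
Definition complexR (R : realType) : numClosedFieldType := R[i].
Arguments complexR : simpl never.

(** * Completeness and monotone convergence in the complex field, through real and imaginary
    parts *)

Section complexR_topology.
Variable R : realType.
Notation C := (complexR R).
Implicit Type z : C.
Local Open Scope complex_scope.

Lemma complexR_normIm z : (`|complex.Im z|%:C : C) <= `|z|.
Proof.
rewrite -[complex.Im z]opprK normrN -ReiNIm (le_trans (normc_ge_Re _))//.
rewrite (normrM (z : R[i]) 'i) [X in _ * X]normc_def /=.
by rewrite expr0n expr1n add0r sqrtr1 mulr1.
Qed.

(** Positivity in the partial order of [C] forces an element to be real, so the radii of the norm
    topology come from [R]. *)
Lemma complexR_posP (e : C) : 0 < e -> exists2 d : R, 0 < d & e = d%:C.
Proof.
move=> e0; have /complex_realP[d de] : (e : R[i]) \is Num.real by exact: gtr0_real.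
by exists d => //; rewrite -ltcR -de.
Qed.

Lemma complexR_cvg (T : Type) (F : set_system T) (f : T -> C) (a b : R) :
  Filter F -> complex.Re (f x) @[x --> F] --> a -> complex.Im (f x) @[x --> F] --> b ->
  f @ F --> (a +i* b : C).
Proof.
move=> FF /cvgrPdist_lt fa /cvgrPdist_lt fb; apply/cvgrPdist_lt => _ /complexR_posP[d d0 ->].
have d20 : 0 < d / 2 by rewrite divr_gt0.
near=> x.
have fax : `|a - complex.Re (f x)| < d / 2 by near: x; exact: fa.
have fbx : `|b - complex.Im (f x)| < d / 2 by near: x; exact: fb.
rewrite [X in `|X|](complexE (_ : R[i])) (le_lt_trans (ler_normD _ _))//.
rewrite (normrM 'i) !normc_def /= !expr0n expr1n /= add0r !addr0 sqrtr1 mul1r !sqrtr_sqr.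
rewrite -rmorphD ltcR (splitr d).
by case: (f x) fax fbx => u v /= fax fbx; rewrite ltrD.
Unshelve. all: by end_near. Qed.

Lemma complexR_complete (F : set_system C) : ProperFilter F -> cauchy F -> cvg F.
Proof.
move=> FF /(cauchyP F) Fc.
(* Serves both [Re] and [Im]: an additive map that does not increase norms sends Cauchy filters to
   Cauchy filters. *)
have part (g : C -> R) : {morph g : x y / x - y} ->
    (forall z, (`|g z|%:C : C) <= `|z|) -> cvg (g @ F).
  move=> gB gle; apply/cauchy_cvgP; apply: cauchy_exP => e e0.
  have [|z Fz] := Fc (e%:C : C); first by rewrite ltcR.
  exists (g z); apply: (@filterS _ F _ _ _ _ Fz) => x zx.
  change (`|g z - g x| < e :> R).
  by rewrite -gB -ltcR (le_lt_trans (gle _)).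
have /cvg_ex[a Fa] : cvg (@complex.Re R @ F).
  by apply: part => [[x1 x2] [y1 y2]|z] //; exact: normc_ge_Re.
have /cvg_ex[b Fb] : cvg (@complex.Im R @ F).
  by apply: part => [[x1 x2] [y1 y2]|z] //; exact: complexR_normIm.
by apply/cvg_ex; exists (a +i* b : C); apply: (complexR_cvg (f := id)).
Qed.

(** The terms are nonnegative, hence real, so monotone convergence in [R] applies to their real
    parts. *)
Lemma complexR_nondecreasing_cvg (u : nat -> C) (M : C) :
  {homo u : m n / (m <= n)%N >-> m <= n} -> (forall n, 0 <= u n) -> (forall n, u n <= M) ->
  cvgn u.
Proof.
move=> und u0 uM; apply/cvg_ex; exists ((limn (fun n => complex.Re (u n))) +i* 0).
apply: complexR_cvg; last first.
  rewrite (_ : (fun _ => _) = cst 0); first exact: cvg_cst.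
  by apply/funext => n; apply: ger0_Im; exact: u0.
apply: nondecreasing_is_cvgn => [m n mn|].
  by have := und _ _ mn; rewrite (lecE (u m : R[i]) (u n)) => /andP[].
exists (complex.Re (M : R[i])) => _ [n _ <-].
by have := uM n; rewrite (lecE (u n : R[i]) M) => /andP[].
Qed.

End complexR_topology.

(** * Exhaustion of the integers by finite boxes *)

Section box.

(* box n = {-n, ..., n-1}; recall that Negz k = -(k+1). *)
Definition box n : seq int :=
  [seq Posz k | k <- iota 0 n] ++ [seq Negz k | k <- iota 0 n].

Lemma mem_box n z :
  (z \in box n) = match z with Posz k => (k < n)%N | Negz k => (k < n)%N end.
Proof.
rewrite mem_cat; apply/orP/idP.
  by case=> /mapP[k]; rewrite mem_iota add0n => kn ->.
by case: z => k kn; [left|right]; apply/mapP; exists k; rewrite // mem_iota.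
Qed.

Lemma mem_boxE n z : (z \in box n) = (- n%:Z <= z < n%:Z).
Proof. by rewrite mem_box; case: z => k; lia. Qed.

Lemma box_uniq n : uniq (box n).
Proof.
rewrite cat_uniq !map_inj_uniq ?iota_uniq; [|by move=> ? ? []..].
by rewrite andbT/=; apply/hasPn => _ /mapP[k _ ->]; apply/mapP => -[].
Qed.

Lemma subset_box m n : (m <= n)%N -> {subset box m <= box n}.
Proof. by move=> mn z; rewrite !mem_box; case: z => k /leq_trans; apply. Qed.

Lemma subset_some_box (s : seq int) : exists n, {subset s <= box n}.
Proof.
exists (\max_(z <- s) absz z).+1 => z zs; rewrite mem_box.
by case: z zs => k zs; rewrite ltnS (leq_trans _ (leq_bigmax_seq _ zs isT))//=.
Qed.

Lemma ler_sum_subset (I : eqType) (K : numDomainType) (s t : seq I) (F : I -> K) :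
  uniq s -> uniq t -> {subset s <= t} -> (forall i, 0 <= F i) ->
  \sum_(i <- s) F i <= \sum_(i <- t) F i.
Proof.
move=> us ut st F0; rewrite [leRHS](bigID (mem s))/= -[X in _ <= X + _]big_filter.
rewrite [X in _ <= X + _](perm_big s)/=; first by rewrite lerDl sumr_ge0.
apply: uniq_perm; rewrite ?filter_uniq// => i; rewrite mem_filter.
by case: (boolP (i \in s)) => //= /st.
Qed.

End box.

(** * The vector space of square-summable families *)

Section l2_type.
Variable R : realType.
Notation C := (complexR R).

Definition l2_pred : {pred int -> C} := fun f =>
  `[< exists M : C, forall n, \sum_(k <- box n) `|f k| ^+ 2 <= M >].

Lemma l2_submod_closed : submod_closed l2_pred.
Proof.
split=> [|a f g /asboolP[M fM] /asboolP[N gN]]; apply/asboolP.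
  by exists 0 => n; rewrite big1// => k _; rewrite normr0 expr0n.
exists (2 * (`|a| ^+ 2 * M + N)) => n.
apply: (@le_trans _ _ (\sum_(k <- box n) 2 * (`|a| ^+ 2 * `|f k| ^+ 2 + `|g k| ^+ 2))).
  apply: ler_sum => k _; rewrite !fctE -exprMn -normrM.
  rewrite (@le_trans _ _ ((`|a * f k| + `|g k|) ^+ 2))//.
    by rewrite lerXn2r ?nnegrE// ?addr_ge0// ler_normD.
  move: (`|a * f k|) (`|g k|) (normr_ge0 (a * f k)) (normr_ge0 (g k)) => x y x0 y0.
  (* The pointwise bound is (x + y)^2 <= 2 (x^2 + y^2). *)
  rewrite -subr_ge0 (_ : _ - _ = (x - y) ^+ 2); last by ring.
  by rewrite real_exprn_even_ge0// rpredB// ger0_real.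
rewrite -mulr_sumr ler_wpM2l// big_split/= -mulr_sumr lerD// ler_wpM2l// exprn_ge0//.
Qed.

Record l2 := L2 { l2_fun :> int -> C; _ : l2_fun \in l2_pred }.

HB.instance Definition _ := [isSub for l2_fun].
HB.instance Definition _ := [Choice of l2 by <:].
HB.instance Definition _ := GRing.isSubmodClosed.Build C (int -> C) l2_pred l2_submod_closed.
HB.instance Definition _ := [SubChoice_isSubLmodule of l2 by <:].

End l2_type.

(** * Limits in partially ordered fields *)

Section limits.
Variables (K : numFieldType) (T : Type) (F : set_system T).
Context {FF : ProperFilter F}.

(* The norm turns x <= y into the closed condition |y - x| = y - x: this avoids
   the order topology, which is not available on partially ordered fields. *)
Lemma ler_numField_cvg (u v : T -> K) (a b : K) :
  u @ F --> a -> v @ F --> b -> (\forall x \near F, u x <= v x) -> a <= b.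
Proof.
move=> ua vb uv; have vua : v x - u x @[x --> F] --> b - a by exact: cvgB.
have nvua : `|v x - u x| @[x --> F] --> b - a.
  apply: cvg_trans vua; apply: near_eq_cvg; apply: filterS uv => x uvx.
  by rewrite ger0_norm// subr_ge0.
have -> : a <= b = (b - a \is Num.nneg) by rewrite nnegrE subr_ge0.
rewrite nnegrE.
suff <- : `|b - a| = b - a by [].
exact: (cvg_unique (@norm_hausdorff _ K^o) (cvg_norm vua) nvua).
Qed.

Lemma cvg_sumr (I : Type) (r : seq I) (u : I -> T -> K) (a : I -> K) :
  (forall i, u i @ F --> a i) -> \sum_(i <- r) u i x @[x --> F] --> \sum_(i <- r) a i.
Proof.
move=> ua; elim: r => [|i r IH].
  by rewrite big_nil; under eq_fun do rewrite big_nil; exact: cvg_cst.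
by rewrite big_cons; under eq_fun do rewrite big_cons; apply: cvgD.
Qed.

End limits.

Lemma cvg_conjC (C : numClosedFieldType) (T : Type) (F : set_system T) {FF : Filter F}
    (u : T -> C) (a : C) :
  u @ F --> a -> (u x)^* @[x --> F] --> a^*.
Proof.
move=> /cvgrPdist_lt ua; apply/cvgrPdist_lt => e /ua; apply: filterS => x.
by rewrite -rmorphB norm_conjC.
Qed.

(** Polarization reduces the convergence of inner product series to that of series of squares, whose
    partial sums are monotone. *)
Lemma mul_conjC_polar (C : numClosedFieldType) (x y : C) :
  x * y^* = 4^-1 * (`|x + y| ^+ 2 - `|x - y| ^+ 2
                    + 'i * (`|x + 'i * y| ^+ 2 - `|x - 'i * y| ^+ 2)).
Proof.
have C4 : (4 : C) != 0 by rewrite pnatr_eq0.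
apply: (mulfI C4); rewrite mulVKf// !normCK !rmorphD !rmorphN !rmorphM/= conjCi.
have := sqrCi C; move: 'i => i i2.
ring: i2.
Qed.

(** * The inner product on l^2(Z) *)

Section l2_inner.
Variable R : realType.
Notation C := (complexR R).
Implicit Types f g h : l2 R.

Lemma l2_sum_is_cvg f : cvgn (fun n => \sum_(k <- box n) `|f k| ^+ 2 : C).
Proof.
have /asboolP[M fM] := valP f.
apply: (@complexR_nondecreasing_cvg _ _ M) => // [m n mn|n].
  by apply: ler_sum_subset (subset_box mn) _; rewrite ?box_uniq// => k; rewrite exprn_ge0.
by apply: sumr_ge0 => k _; rewrite exprn_ge0.
Qed.

Lemma l2_inner_is_cvg f g : cvgn (fun n => \sum_(k <- box n) f k * (g k)^* : C).
Proof.
have -> : (fun n => \sum_(k <- box n) f k * (g k)^* : C) =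
  (fun n => 4^-1 * (\sum_(k <- box n) `|(f + g) k| ^+ 2
    - \sum_(k <- box n) `|(f - g) k| ^+ 2
    + 'i * (\sum_(k <- box n) `|(f + 'i *: g) k| ^+ 2
      - \sum_(k <- box n) `|(f - 'i *: g) k| ^+ 2))).
  apply/funext => n; rewrite -!sumrB mulr_sumr -big_split/= mulr_sumr.
  by apply: eq_bigr => k _; rewrite mul_conjC_polar.
have sq h := @l2_sum_is_cvg h.
apply: is_cvgMl_tmp; apply: is_cvgD; first exact: is_cvgB.
by apply: is_cvgMl_tmp; exact: is_cvgB.
Qed.

Definition l2_inner f g : C := limn (fun n => \sum_(k <- box n) f k * (g k)^*).

Lemma l2_inner_cvg f g : \sum_(k <- box n) f k * (g k)^* @[n --> \oo] --> l2_inner f g.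
Proof. exact: l2_inner_is_cvg. Qed.

Lemma l2_inner_unique f g (a : C) :
  \sum_(k <- box n) f k * (g k)^* @[n --> \oo] --> a -> l2_inner f g = a.
Proof.
by move=> fga; apply: cvg_lim fga; exact: norm_hausdorff.
Qed.

Lemma l2_inner_sq_cvg f : \sum_(k <- box n) `|f k| ^+ 2 @[n --> \oo] --> l2_inner f f.
Proof.
apply: cvg_trans (@l2_inner_cvg f f); apply: near_eq_cvg; near=> n.
by apply: eq_bigr => k _; rewrite normCK.
Unshelve. all: by end_near. Qed.

(** A finite set of indices lies in every large box, so its sum is eventually below the partial
    sums, hence below their limit. *)
Lemma l2_sum_le (s : seq int) f : uniq s -> \sum_(k <- s) `|f k| ^+ 2 <= l2_inner f f.
Proof.
move=> us; have [m sm] := subset_some_box s.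
apply: (@ler_numField_cvg C _ \oo _ (cst (\sum_(k <- s) `|f k| ^+ 2)) _ _ _ (cvg_cst _)
  (@l2_inner_sq_cvg f)).
near=> n.
apply: ler_sum_subset => //; first exact: box_uniq.
  by move=> z /sm; apply: subset_box; near: n; exact: nbhs_infty_ge.
by move=> k; rewrite exprn_ge0.
Unshelve. all: by end_near. Qed.

Lemma l2_inner_le f (M : C) :
  (forall n, \sum_(k <- box n) `|f k| ^+ 2 <= M) -> l2_inner f f <= M.
Proof.
move=> fM; apply: (@ler_numField_cvg C _ \oo _ _ (cst M) _ _ (@l2_inner_sq_cvg f) (cvg_cst M)).
by near=> n; exact: fM.
Unshelve. all: by end_near. Qed.

Lemma l2_inner_herm f g : l2_inner f g = (-1) ^+ false * (l2_inner g f)^*.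
Proof.
rewrite expr0 mul1r; apply: l2_inner_unique.
apply: cvg_trans (cvg_conjC (@l2_inner_cvg g f)); apply: near_eq_cvg; near=> n.
by rewrite rmorph_sum; apply: eq_bigr => k _; rewrite rmorphM/= conjCK mulrC.
Unshelve. all: by end_near. Qed.

Lemma l2_inner_bilinear : @bilinear_for C (l2 R) (l2 R) C *%R (@Num.conj C \; *%R) l2_inner.
Proof.
have lin h : GRing.linear_for *%R (l2_inner^~ h).
  move=> a f g; apply: l2_inner_unique.
  apply: cvg_trans (cvgD (cvgMl_tmp (a := a) (@l2_inner_cvg f h)) (@l2_inner_cvg g h)).
  apply: near_eq_cvg; near=> n.
  rewrite fctE mulr_sumr -big_split/=; apply: eq_bigr => k _.
  by rewrite -[RHS]/((a * f k + g k) * (h k)^*) mulrDl mulrA.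
split=> // h a f g.
rewrite l2_inner_herm lin expr0 mul1r rmorphD rmorphM/=.
by rewrite (l2_inner_herm h f) (l2_inner_herm h g) !expr0 !mul1r.
Unshelve. all: by end_near. Qed.

Lemma l2_inner_gt0 f : f != 0 -> 0 < l2_inner f f.
Proof.
(* The empty list yields nonnegativity; singletons then show that a zero value kills every
   coordinate. *)
move=> f0; rewrite lt_def; have := l2_sum_le f (isT : uniq [::]).
rewrite big_nil => ->; rewrite andbT; apply: contra_neq f0 => ff.
apply/val_inj/funext => k; apply/eqP; rewrite -normr_eq0 -sqrf_eq0 eq_le exprn_ge0// andbT.
by have := l2_sum_le f (isT : uniq [:: k]); rewrite big_seq1 ff.
Qed.

HB.instance Definition _ := bilinear_isBilinear.Build C (l2 R) (l2 R) C
  *%R (@Num.conj C \; *%R) l2_inner l2_inner_bilinear.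

HB.instance Definition _ := isHermitianSesquilinear.Build C (l2 R) false (@Num.conj C)
  l2_inner l2_inner_herm.

HB.instance Definition _ := isDotProduct.Build C (l2 R) l2_inner l2_inner_gt0.

Definition l2_dot : {dot (l2 R) for (@Num.conj C)} := l2_inner.

End l2_inner.

(** * Cauchy-Schwarz, the triangle inequality and polarization *)

Section dot_theory.
Variables (C : numClosedFieldType) (U : lmodType C) (form : {dot U for (@Num.conj C)}).
Local Notation "''[' u , v ]" := (form u v).
Local Notation "''[' u ]" := (form u u).

Lemma dot_cauchy_schwarz u v : `|'[u, v]| <= sqrtC '[u] * sqrtC '[v].
Proof.
have [->|v0] := eqVneq v 0; first by rewrite !linear0r normr0 sqrtC0 mulr0.
have vv0 : 0 < '[v] by rewrite dnorm_gt0.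
rewrite -sqrtCM ?nnegrE ?dnorm_ge0// -(ler_pXn2r (isT : (0 < 2)%N)) ?nnegrE//; last first.
  by rewrite sqrtC_ge0 mulr_ge0// dnorm_ge0.
rewrite sqrtCK -(ler_pM2r vv0) -subr_ge0.
(* This vector is ['[v]] times the component of [u] orthogonal to [v]. Its square expands to exactly
   the difference in the goal, which was multiplied by ['[v]] to avoid a division. *)
have := dnorm_ge0 form ('[v] *: u - '[u, v] *: v).
rewrite dnormB !dnormZ /= linearZl_LR/= linearZr_LR/= !rmorphM/= conjCK.
rewrite (geC0_conj (ltW vv0)) (ger0_norm (ltW vv0)) normCK.
by congr (_ <= _); ring.
Qed.

Lemma dot_triangle u v : sqrtC '[u + v] <= sqrtC '[u] + sqrtC '[v].
Proof.
have s0 w : 0 <= sqrtC '[w] by rewrite sqrtC_ge0 dnorm_ge0.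
rewrite -(ler_pXn2r (isT : (0 < 2)%N)) ?nnegrE ?addr_ge0// sqrrD !sqrtCK dnormD.
rewrite addrAC lerD2r lerD2l.
(* The cross term must be real to be comparable with its norm in the partial order of [C]. *)
have dr : '[u, v] + ('[u, v])^* \is Num.real by rewrite CrealE rmorphD/= conjCK addrC.
rewrite (le_trans (real_ler_norm dr))// (le_trans (ler_normD _ _))// norm_conjC -mulr2n.
by rewrite lerMn2r dot_cauchy_schwarz orbT.
Qed.

End dot_theory.

(** Expresses the inner product by norms alone, so that a linear isometry preserves inner products;
    this gives the adjoint of the shift. *)
Lemma hilbert_polar (K : numClosedFieldType) (G : hilbertType K) (x y : G) :
  '<x, y> = 4^-1 * (`|x + y| ^+ 2 - `|x - y| ^+ 2
                    + 'i * (`|x + 'i *: y| ^+ 2 - `|x - 'i *: y| ^+ 2)).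
Proof.
have K4 : (4 : K) != 0 by rewrite pnatr_eq0.
apply: (mulfI K4); rewrite mulVKf// -!inner_norm !dnormB !dnormD !dnormZ/= linearZr_LR/=.
rewrite rmorphM/= conjCK conjCi.
have := sqrCi K; move: 'i ('<x, y>) (Num.conj '<x, y>) => i d e i2.
ring: i2.
Qed.

Lemma hilbert_cauchy_schwarz (K : numClosedFieldType) (G : hilbertType K) (x y : G) :
  `|'<x, y>| <= `|x| * `|y|.
Proof.
have := dot_cauchy_schwarz (@inner K G) x y.
by rewrite !inner_norm !sqrCK.
Qed.

(** * The norm and the completeness of l^2(Z) *)

Section l2_hilbert.
Variable R : realType.
Notation C := (complexR R).
Implicit Types f g h : l2 R.

Definition l2_norm f : C := sqrtC (l2_inner f f).

Lemma l2_normD f g : l2_norm (f + g) <= l2_norm f + l2_norm g.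
Proof. exact: (dot_triangle (@l2_dot R)). Qed.

Lemma l2_normZ (a : C) f : l2_norm (a *: f) = `|a| * l2_norm f.
Proof.
rewrite /l2_norm (dnormZ (@l2_dot R)) sqrtCM ?nnegrE ?exprn_ge0 ?(dnorm_ge0 (@l2_dot R))//.
by rewrite sqrCK.
Qed.

Lemma l2_norm_eq0 f : l2_norm f = 0 -> f = 0.
Proof. by move=> /eqP; rewrite (sqrt_dnorm_eq0 (@l2_dot R)) => /eqP. Qed.

HB.instance Definition _ :=
  Lmodule_isNormed.Build C (l2 R) l2_normD l2_normZ l2_norm_eq0.

Lemma l2_inner_norm f : l2_inner f f = `|f| ^+ 2.
Proof. by rewrite [`|f|]/(l2_norm f) sqrtCK. Qed.

Lemma l2_norm_le f (e : C) : 0 <= e ->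
  (forall n, \sum_(k <- box n) `|f k| ^+ 2 <= e ^+ 2) -> `|f| <= e.
Proof.
move=> e0 fe; rewrite -(ler_pXn2r (isT : (0 < 2)%N)) ?nnegrE//.
by rewrite -l2_inner_norm l2_inner_le.
Qed.

Lemma l2_coord_le f k : `|f k| <= `|f|.
Proof.
rewrite -(ler_pXn2r (isT : (0 < 2)%N)) ?nnegrE// -l2_inner_norm.
by have := l2_sum_le f (isT : uniq [:: k]); rewrite big_seq1.
Qed.

(** The limit [g] is built coordinatewise. Norm bounds pass to the limit on each finite box, and
    since they do not depend on the box they hold for the whole family. *)
Lemma l2_complete (F : set_system (l2 R)) : ProperFilter F -> cauchy F -> cvg F.
Proof.
move=> FF /(cauchyP F) Fc.
have coord k : cvg ((fun f => f k) @ F).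
  apply: complexR_complete; apply: cauchy_exP => e /Fc[h Fh].
  exists (h k); apply: (@filterS _ F _ _ _ _ Fh) => f hf.
  change (`|(h - f) k| < e).
  exact: le_lt_trans (l2_coord_le (h - f) k) hf.
pose g k : C := lim ((fun f => f k) @ F).
have gF (e : C) h : (\forall f \near F, `|h - f| < e) ->
    forall n, \sum_(k <- box n) `|h k - g k| ^+ 2 <= e ^+ 2.
  move=> hF n.
  have sumF : (fun f : l2 R => \sum_(k <- box n) `|h k - f k| ^+ 2) @ F -->
      (\sum_(k <- box n) `|h k - g k| ^+ 2 : C).
    apply: cvg_sumr => k; under eq_fun do rewrite expr2; rewrite expr2.
    have hg : (fun f : l2 R => `|h k - f k|) @ F --> `|h k - g k|.
      by apply: cvg_norm; apply: cvgB; [exact: cvg_cst|exact: coord].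
    exact: cvgM.
  apply: (ler_numField_cvg sumF (cvg_cst (e ^+ 2))); apply: filterS hF => f hf.
  rewrite (le_trans (l2_sum_le (h - f) (box_uniq n)))//.
  by rewrite l2_inner_norm lerXn2r ?nnegrE// ltW// (le_lt_trans _ hf).
(* [g] is the difference of some [h] in l^2 and of [h - g], which is square-summable by [gF]. *)
have g_l2 : g \in @l2_pred R.
  have [h Fh] := Fc 1 ltr01.
  have hg : (h : int -> C) - g \in @l2_pred R.
    by apply/asboolP; exists (1 ^+ 2) => n; exact: (gF 1 h).
  by rewrite -[g](subKr (h : int -> C)) rpredB//; case: h {Fh hg}.
apply/cvg_ex; exists (L2 g_l2); apply/cvgrPdist_lt => e e0.
have e20 : 0 < e / 2 by rewrite divr_gt0.
have [h Fh] := Fc _ e20.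
have hg : `|h - L2 g_l2| <= e / 2 by apply: l2_norm_le (ltW e20) _; exact: gF.
apply: (@filterS _ F _ _ _ _ Fh) => f hf.
rewrite -(subrKA h) (splitr e) (le_lt_trans (ler_normD _ _))// ler_ltD//.
by rewrite distrC.
Qed.

HB.instance Definition _ := Uniform_isComplete.Build (l2 R) l2_complete.

HB.instance Definition _ :=
  CompleteNormedModule_isHilbert.Build C (l2 R) l2_inner_norm.

Definition l2_hilbert : hilbertType C := l2 R.

End l2_hilbert.

(** * Weighted compositions: the common form of the shifts, the truncations and the operator A *)

Section weighted_composition.
Variable R : realType.
Notation C := (complexR R).
Notation H := (l2_hilbert R).
Variables (m : int -> C) (s : int -> int).
Hypotheses (m_le1 : forall k, `|m k| <= 1) (s_inj : injective s).

(** Injectivity of [s] makes the image of the box duplicate-free, so the sum is dominated by a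
    finite part of the squared norm of [f]. *)
Lemma wcomp_sum_le (f : l2 R) n :
  \sum_(k <- box n) `|m k * f (s k)| ^+ 2 <= l2_inner f f.
Proof.
apply: le_trans (l2_sum_le f (_ : uniq [seq s k | k <- box n])); last first.
  by rewrite map_inj_uniq ?box_uniq.
rewrite big_map; apply: ler_sum => k _; rewrite normrM exprMn ler_piMl ?exprn_ge0//.
by rewrite exprn_ile1.
Qed.

Lemma wcomp_l2 (f : l2 R) : (fun k => m k * f (s k)) \in @l2_pred R.
Proof. by apply/asboolP; exists (l2_inner f f) => n; exact: wcomp_sum_le. Qed.

Definition wcomp (f : H) : H := L2 (wcomp_l2 f).

Lemma wcomp_norm_le f : `|wcomp f| <= 1 * `|f|.
Proof.
by rewrite mul1r; apply: l2_norm_le => // n; rewrite -l2_inner_norm; exact: wcomp_sum_le.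
Qed.

Lemma wcomp_bounded : wcomp \in @bounded_operator_pred C H.
Proof.
apply/asboolP; split=> [a f g|]; last by exists 1; exact: wcomp_norm_le.
apply/val_inj/funext => k.
rewrite -[LHS]/(m k * (a * f (s k) + g (s k))) -[RHS]/(a * (m k * f (s k)) + m k * g (s k)).
by rewrite mulrDr mulrCA.
Qed.

Definition wcomp_op : 'L(H) := BoundedOperator wcomp_bounded.

End weighted_composition.

(** * The group of bilateral shifts *)

Section shift.
Variable R : realType.
Notation C := (complexR R).
Notation H := (l2_hilbert R).
Implicit Types f g : H.

Lemma norm_cst1_le1 (k : int) : `|cst 1 k : C| <= 1.
Proof. by rewrite normr1. Qed.

(** Acting on the argument reverses the direction: the shift e_k |-> e_{k+1} is [bshift (-1)]. *)
Definition bshift (a : int) : 'L(H) := wcomp_op norm_cst1_le1 (addIr a).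

Lemma bshiftE a f k : bshift a f k = f (k + a). Proof. exact: mul1r. Qed.

Lemma bshiftD a b : bshift a * bshift b = bshift (a + b).
Proof.
apply: bounded_operator_ext => f; apply/val_inj/funext => k.
by rewrite -[LHS]/(bshift a (bshift b f) k) -[RHS]/(bshift (a + b) f k) !bshiftE addrA.
Qed.

Lemma bshift0 : bshift 0 = 1.
Proof.
apply: bounded_operator_ext => f; apply/val_inj/funext => k.
by rewrite -[LHS]/(bshift 0 f k) bshiftE addr0.
Qed.

Lemma bshiftX a n : bshift a ^+ n = bshift (a *+ n).
Proof. by elim: n => [|n IH]; rewrite ?bshift0// exprS IH bshiftD mulrS. Qed.

Lemma bshift_norm_le a f : `|bshift a f| <= `|f|.
Proof. by rewrite (le_trans (wcomp_norm_le _ _ _))// mul1r. Qed.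

(** The reverse inequality is contractivity of the inverse [bshift (- a)]. *)
Lemma bshift_norm a f : `|bshift a f| = `|f|.
Proof.
apply/eqP; rewrite eq_le bshift_norm_le/=.
rewrite -{1}[f]/((1 : 'L(H)) f) -bshift0 -(subrr a) addrC -bshiftD.
exact: bshift_norm_le.
Qed.

(** Once [f] is written as [bshift (- a) (bshift a f)], both arguments on the right carry the
    isometry [bshift (- a)], which polarization removes. *)
Lemma bshift_adjoint a : is_adjoint (bshift a) (bshift (- a)).
Proof.
move=> f g.
have -> : f = bshift (- a) (bshift a f).
  by rewrite -[RHS]/((bshift (- a) * bshift a) f) bshiftD addNr bshift0.
rewrite [RHS]hilbert_polar -!linearZ -!linearB -!linearD !bshift_norm -hilbert_polar.
by rewrite -[bshift (- a) (bshift a f)]/((bshift (- a) * bshift a) f) bshiftD addNr bshift0.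
Qed.

Lemma bshift_unitary a : unitary (bshift a).
Proof.
by exists (bshift (- a)); split; [exact: bshift_adjoint|rewrite bshiftD ?subrr ?addNr bshift0..].
Qed.

End shift.

(** * Truncations and weak stability of the shift *)

Section weak_stability.
Variable R : realType.
Notation C := (complexR R).
Notation H := (l2_hilbert R).
Implicit Types f g : H.

Lemma norm_indicator_le1 (P : pred int) k : `|(P k)%:R : C| <= 1.
Proof. by case: (P k); rewrite ?normr1 ?normr0. Qed.

Definition trunc n : 'L(H) :=
  wcomp_op (norm_indicator_le1 (mem (box n))) (@inj_id int).

Lemma truncE n f k : trunc n f k = (k \in box n)%:R * f k. Proof. by []. Qed.

(** A finite part of the tail and [box n] are disjoint, so their two sums together are at most the
    squared norm of [f]. *)
Lemma trunc_sum_le n f :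
  `|f - trunc n f| ^+ 2 <= `|f| ^+ 2 - \sum_(k <- box n) `|f k| ^+ 2.
Proof.
rewrite -!l2_inner_norm; apply: l2_inner_le => j; rewrite lerBrDl.
have u : uniq (box n ++ [seq k <- box j | k \notin box n]).
  rewrite cat_uniq filter_uniq ?box_uniq// andbT/=.
  by apply/hasPn => k; rewrite mem_filter => /andP[].
apply: le_trans (l2_sum_le f u); rewrite [leRHS]big_cat lerD2l big_filter.
rewrite [leRHS]big_mkcond; apply: ler_sum => k _.
rewrite -[(f - trunc n f) k]/(f k - (k \in box n)%:R * f k).
by case: (k \in box n); rewrite /= ?mul1r ?mul0r ?subrr ?subr0 ?normr0 ?expr0n.
Qed.

Lemma trunc_cvg f (e : C) : 0 < e -> \forall n \near \oo, `|f - trunc n f| < e.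
Proof.
move=> e0; have /cvgrPdist_lt/(_ (e ^+ 2)) := @l2_inner_sq_cvg R f.
rewrite exprn_gt0// => /(_ isT); apply: filterS => n fn.
rewrite -(ltr_pXn2r (isT : (0 < 2)%N)) ?nnegrE//; last exact: ltW.
apply: le_lt_trans (trunc_sum_le n f) _; rewrite -l2_inner_norm.
by rewrite (le_lt_trans _ fn)// ger0_norm// subr_ge0 l2_sum_le// box_uniq.
Qed.

Lemma trunc_norm_le n f : `|trunc n f| <= `|f|.
Proof. by rewrite (le_trans (wcomp_norm_le _ _ _))// mul1r. Qed.

Lemma bshift_trunc_orthogonal n j f g : (n.*2 <= j)%N ->
  '<bshift R (- j%:Z) (trunc n f), trunc n g> = 0.
Proof.
move=> nj; apply: l2_inner_unique.
rewrite (_ : (fun _ => _) = cst 0); first exact: cvg_cst.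
apply/funext => p; rewrite big1// => k _.
rewrite bshiftE !truncE !mem_boxE.
have [kn|] := boolP (- n%:Z <= k < n%:Z); last by rewrite mul0r rmorph0 mulr0.
(* From k < n and 2n <= j follows k - j < -n: the shifted truncation vanishes at k. *)
by rewrite (_ : (_ <= k - _ < _) = false) ?mul0r//; lia.
Qed.

Lemma bshift_weakly_stable : weakly_stable (bshift R (-1)).
Proof.
apply/cvg_wotP => f g; rewrite (_ : '<_, g> = 0); last exact: linear0l.
apply/cvgrPdist_lt => e e0.
(* The summand 1 keeps [M] positive when [f] and [g] vanish and makes the final bound e / M * (|f| +
   |g|) < e strict. *)
pose M : C := `|f| + `|g| + 1.
have M0 : 0 < M by rewrite ltr_wpDl// addr_ge0.
have d0 : 0 < e / M by rewrite divr_gt0.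
near \oo => n.
have fn : `|f - trunc n f| < e / M by near: n; exact: trunc_cvg.
have gn : `|g - trunc n g| < e / M by near: n; exact: trunc_cvg.
suff : \forall j \near \oo, `|0 - '<(bshift R (-1) ^+ j) f, g>| < e by [].
exists n.*2 => // j /= nj.
rewrite sub0r normrN bshiftX mulNrn pmulrn.
rewrite (_ : 1 *~ j = j%:Z); last by rewrite -[1 *~ j]/(j%:~R) intz.
set T := bshift R _.
(* The term with both truncations is zero by orthogonality; each remaining term contains one small
   truncation error. *)
have -> : '<T f, g> = '<T f, g - trunc n g> + '<T (f - trunc n f), trunc n g>.
  rewrite -{1}[g](subrK (trunc n g)) linearDr; congr (_ + _).
  rewrite -{1}[f](subrK (trunc n f)) (linearD T) linearDl -[RHS]addr0; congr (_ + _).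
  exact: bshift_trunc_orthogonal.
apply: le_lt_trans (ler_normD _ _) _.
apply: (@le_lt_trans _ _ (e / M * (`|f| + `|g|))).
  rewrite mulrDr lerD// (le_trans (hilbert_cauchy_schwarz _ _))//.
    by rewrite mulrC ler_pM//; [exact: ltW|exact: bshift_norm_le].
  by rewrite ler_pM// ?trunc_norm_le// (le_trans (bshift_norm_le _ _))// ltW.
by rewrite -[ltRHS](divfK (lt0r_neq0 M0)) ltr_pM2l// ltrDl.
Unshelve. all: by end_near. Qed.

End weak_stability.

(** * A 0-1 sequence with divergent Cesàro means *)

Definition even_log n : bool := ~~ odd (trunc_log 2 n).

Lemma sum_even_log_block k :
  (\sum_(2 ^ k <= n < 2 ^ k.+1) even_log n = (~~ odd k) * 2 ^ k)%N.
Proof.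
rewrite (@eq_big_nat _ _ _ _ _ _ (fun=> (~~ odd k : nat))) => [|n nk]; last first.
  by rewrite /even_log (trunc_log_eq _ nk).
by rewrite sum_nat_const_nat expnS mul2n -addnn addnK mulnC.
Qed.

(** Blocks of odd index add nothing, and the block of index 2j adds 4^j, which turns 3 S + 1 = 4^j
    into 3 S' + 1 = 4 * 4^j. Clearing the denominator 3 keeps the statement in [nat]. *)
Lemma sum_even_log j :
  (3 * \sum_(1 <= n < 2 ^ j.*2) even_log n + 1 = 2 ^ j.*2
   /\ 3 * \sum_(1 <= n < 2 ^ j.*2.+1) even_log n + 1 = 2 * 2 ^ j.*2.+1)%N.
Proof.
have split k : (\sum_(1 <= n < 2 ^ k.+1) even_log n =
    \sum_(1 <= n < 2 ^ k) even_log n + (~~ odd k) * 2 ^ k)%N.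
  by rewrite (@big_cat_nat _ _ _ (2 ^ k))/= ?expn_gt0// ?leq_exp2l// sum_even_log_block.
have step i : (3 * \sum_(1 <= n < 2 ^ i.*2) even_log n + 1 = 2 ^ i.*2 ->
    3 * \sum_(1 <= n < 2 ^ i.*2.+1) even_log n + 1 = 2 * 2 ^ i.*2.+1)%N.
  by rewrite split odd_double !expnS; lia.
elim: j => [|j [_ IH]]; first by split=> //; [rewrite big_geq|apply: step; rewrite big_geq].
have H : (3 * \sum_(1 <= n < 2 ^ j.+1.*2) even_log n + 1 = 2 ^ j.+1.*2)%N.
  by rewrite doubleS split/= odd_double/= addn0 IH -expnS.
by split=> //; exact: step.
Qed.

Lemma cesaro_even_log_dvg (K : numFieldType) (L : K) :
  ~ (N%:R^-1 * \sum_(1 <= n < N.+1) (even_log n)%:R @[N --> \oo] --> L).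
Proof.
(* The tolerance 1/6 is half the gap between the values 1/3 and 2/3. *)
move=> /cvgrPdist_lt/(_ 6^-1); rewrite invr_gt0 ltr0n => /(_ isT)[N0 _ NL].
(* The successor makes the exponent positive, so that the index [(2 ^ k).-1] is nonzero as well as
   beyond [N0]. *)
have [E O] := sum_even_log N0.+1.
set k := N0.+1.*2 in E O.
have N0k : (N0.+2 < 2 ^ k)%N by rewrite (leq_trans _ (ltn_expl k _))// /k; lia.
have := NL (2 ^ k.+1).-1; have := NL (2 ^ k).-1.
rewrite /= !prednK ?expn_gt0// -!natr_sum.
set S := (\sum_(1 <= n < _) _)%N in E *; set S' := (\sum_(1 <= n < _) _)%N in O *.
have S0 : (0 < S)%N by lia.
have -> : (2 ^ k).-1 = (3 * S)%N by lia.
have n0 : (N0 < (2 ^ k.+1).-1)%N by rewrite expnS; lia.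
have n'S : (3 * S' = 2 * (2 ^ k.+1).-1 + 1)%N by move: O; rewrite expnS; lia.
move: (2 ^ k.+1).-1 n0 n'S => n n0 n'S.
have -> : (3 * S)%:R^-1 * S%:R = 3^-1 :> K.
  by rewrite natrM invfM divfK ?pnatr_eq0//; lia.
move=> Lx Ly.
have y23 : 2 * 3^-1 <= n%:R^-1 * S'%:R :> K.
  rewrite ler_pdivlMl; last by rewrite ltr0n; lia.
  rewrite mulrA ler_pdivrMr ?ltr0n//.
  by rewrite -!natrM ler_nat; lia.
have : `|n%:R^-1 * S'%:R - 3^-1| < 6^-1 + 6^-1 :> K.
  rewrite -(subrKA L) (le_lt_trans (ler_normD _ _))// ltrD//.
    by rewrite distrC; apply: Ly; rewrite /=; lia.
  by apply: Lx; rewrite /=; lia.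
have -> : 6^-1 + 6^-1 = 2 * 3^-1 - 3^-1 :> K by field.
apply/negP; rewrite -real_leNgt ?realB ?ger0_real// ?mulr_ge0 ?invr_ge0 ?ler0n//.
rewrite ger0_norm ?lerB// subr_ge0 (le_trans _ y23)//.
by rewrite ler_peMl ?ler1n ?invr_ge0 ?ler0n.
Qed.

(** * The operator A and the failure of convergence *)

Section counterexample.
Variable R : realType.
Notation C := (complexR R).
Notation H := (l2_hilbert R).

(** In coordinates (A f)(k) = c_{|k|} f(-k), which is A e_k = c_{|k|} e_{-k}. *)
Definition cesaro_op : 'L(H) :=
  wcomp_op (@norm_indicator_le1 R (fun k => even_log (absz k))) (@oppr_inj int).

Lemma delta_l2 : (fun k : int => (k == 0)%:R) \in @l2_pred R.
Proof.
apply/asboolP; exists 1 => n.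
have off k : k != 0 -> `|(k == 0)%:R| ^+ 2 = 0 :> C by move=> /negPf->; rewrite normr0 expr0n.
have [n0|n0] := boolP (0 \in box n).
  by rewrite (bigD1_seq 0) ?box_uniq//= normr1 expr1n big1 ?addr0// => k /off.
by rewrite big_seq big1// => k kn; apply: off; apply: contraTneq kn => ->.
Qed.

Definition delta : H := L2 delta_l2.

Lemma inner_delta (f : H) : '<f, delta> = f 0.
Proof.
apply: l2_inner_unique; apply: (@cvg_trans _ (cst (f 0) @ \oo)); last exact: cvg_cst.
apply: near_eq_cvg; near=> n.
(* [box 0] is empty, so the index 0 is available only for n > 0. *)
rewrite (bigD1_seq 0) ?box_uniq//=; last by rewrite mem_box; near: n; exact: nbhs_infty_gt.
by rewrite conjC1 mulr1 big1 ?addr0// => k /negPf->; rewrite conjC0 mulr0.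
Unshelve. all: by end_near. Qed.

(** The vector e_0 is shifted to e_n, sent by A to c_n e_{-n}, and shifted back to c_n e_0. *)
Lemma cesaro_coef n :
  '<(bshift R (-1) ^+ n * cesaro_op * bshift R (-1) ^+ n) delta, delta> = (even_log n)%:R.
Proof.
rewrite inner_delta bshiftX.
set a : int := -1 *+ n.
rewrite -[LHS]/(bshift R a (cesaro_op (bshift R a delta)) 0) bshiftE.
rewrite -[LHS]/((even_log (absz (0 + a)))%:R * bshift R a delta (- (0 + a))) bshiftE.
rewrite -[delta _]/((_ == 0)%:R) add0r addNr eqxx mulr1.
by rewrite /a mulNrn abszN pmulrn -[1 *~ n]/(n%:~R) intz.
Qed.

Lemma cesaro_mean_coef N :
  '<(N%:R^-1 *: \sum_(1 <= n < N.+1)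
      bshift R (-1) ^+ n * cesaro_op * bshift R (-1) ^+ n) delta, delta>
  = N%:R^-1 * \sum_(1 <= n < N.+1) (even_log n)%:R.
Proof.
set S := (X in _ *: X).
rewrite -[LHS]/('<N%:R^-1 *: S delta, delta>) linearZl_LR.
congr (_ * _).
rewrite /S; elim: (index_iota 1 N.+1) => [|n r IH].
  by rewrite !big_nil; exact: linear0l.
by rewrite !big_cons -IH -cesaro_coef; exact: linearDl.
Qed.

(** A weak limit would make the single coefficient at ([delta], [delta]) converge, contrary to the
    divergence of the means of [even_log]. *)
Lemma cesaro_not_cvg : ~ exists B : 'L(H),
  (fun N : nat => N%:R^-1 *: \sum_(1 <= n < N.+1)
     bshift R (-1) ^+ n * cesaro_op * bshift R (-1) ^+ n : wot H) @ \oo --> (B : wot H).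
Proof.
move=> [B /cvg_wotP/(_ delta delta) BN].
apply: (@cesaro_even_log_dvg C '<B delta, delta>); apply: cvg_trans BN.
by apply: near_eq_cvg; near=> N; exact: cesaro_mean_coef.
Unshelve. all: by end_near. Qed.

End counterexample.

Theorem proposition1 (R : realType) :
  exists (H : hilbertType R[i]) (U A : 'L(H)),
    [/\ unitary U, weakly_stable U &
      ~ exists B : 'L(H),
        (fun N : nat => N%:R^-1 *: \sum_(1 <= n < N.+1) U ^+ n * A * U ^+ n
           : wot H) @ \oo --> (B : wot H)].
Proof.
exists (l2_hilbert R), (bshift R (-1)), (cesaro_op R).
split; [exact: bshift_unitary|exact: bshift_weakly_stable|exact: cesaro_not_cvg].
Qed.
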